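(* Let $\epsilon>0$ and let $W_d^\ell\in\mathcal D^\ell$, $\ell\in[L]$, be desired memductance matrices. Then the full writing procedure (described in the context) solves the writing problem within finite time: for any initial conditions $\varphi_0^\ell\in\mathbb{R}^{n_\ell\times n_{\ell-1}}$, $\ell\in[L]$, each phase of the procedure reaches its termination criterion at some finite time $\hat T^\ell_{kj}\ge0$ (measured from the start of that phase), and at the total time $$T_{\mathrm{tot}}=\sum_{\ell=1}^{L}\sum_{k=1}^{n_\ell}\sum_{j=1}^{n_{\ell-1}}\hat T^\ell_{kj}$$ the resulting fluxes satisfy $$\left|W^\ell_{d,kj}-W\bigl(\varphi^\ell_{kj}(T_{\mathrm{tot}})\bigr)\right|\le\epsilon\qquad\text{for all }\ell\in[L],\ k\in[n_\ell],\ j\in[n_{\ell-1}].$$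
   Context: Notation: $[n]=\{1,\dots,n\}$; $\mathbb 1_m\in\mathbb{R}^m$ is the all-ones column vector; $\odot$ is the entrywise (Hadamard) product. $L\ge 1$ and $n_0,\dots,n_L$ are positive integers. Activation function: $\sigma:\mathbb{R}\to\mathbb{R}$ is continuously differentiable, odd, strictly monotone (meaning $(\sigma(x)-\sigma(y))(x-y)>0$ for all $x\ne y$) and $\eta$-Lipschitz continuous, $\eta>0$. $\sigma^\ell:\mathbb{R}^{n_\ell}\to\mathbb{R}^{n_\ell}$ is the entrywise application of $\sigma$. Memristors: $g:\mathbb{R}\to\mathbb{R}$ is continuously differentiable with $W(\varphi):=\frac{dg(\varphi)}{d\varphi}>0$ for all $\varphi\in\mathbb{R}$; $W$ is strictly monotone (meaning $(W(x)-W(y))(x-y)>0$ for all $x\ne y$), $\beta$-Lipschitz continuous, $\beta>0$, and there are constants $W_{\max}\ge W_{\min}>0$ with $W_{\max}\ge W(x)\ge W_{\min}$ for all $x\in\mathbb{R}$. For a matrix $\varphi$, $W(\varphi)$ is the matrix obtained by applying $W$ entrywise. The set of realizable memductance matrices of layer $\ell$ is $$\mathcal D^\ell=\{X\in\mathbb{R}_{>0}^{n_\ell\times n_{\ell-1}}\mid \exists\,\varphi^\ell\in\mathbb{R}^{n_\ell\times n_{\ell-1}}:\ X=W(\varphi^\ell)\}.$$ Circuit equations: with flux matrices $\varphi^\ell(t)\in\mathbb{R}^{n_\ell\times n_{\ell-1}}$, switch matrices $S^\ell(t)\in\{0,1\}^{n_\ell\times n_{\ell-1}}$ and input $P^0(t)\in\mathbb{R}^{n_0}$,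 $$\tfrac{d}{dt}\varphi^\ell=S^\ell\odot(\mathbb 1_{n_\ell}(P^{\ell-1})^\top),\quad \bar J^\ell=(W(\varphi^\ell)\odot S^\ell)P^{\ell-1},\quad P^\ell=\sigma^\ell(\bar J^\ell)\qquad(\ell\in[L]),$$ the differential equations being understood in integrated form, since inputs and switch signals are only piecewise constant in the relevant components. Path: a path to the $(k,j)$-th memristor in layer $\ell$ is a tuple $\gamma=(\gamma_0,\dots,\gamma_\ell)$ with $\gamma_\kappa\in[n_\kappa]$, $\gamma_{\ell-1}=j$, $\gamma_\ell=k$. Switch settings corresponding to $\gamma$: for $\kappa\in[\ell]$, $S^\kappa_{ab}=1$ if $a=\gamma_\kappa$ and $b=\gamma_{\kappa-1}$, and $S^\kappa_{ab}=0$ otherwise; if $\ell<L$, $S^{\ell+1}=0$, and $S^\kappa$ is arbitrary for $\kappa\in\{\ell+2,\dots,L\}$. (Components $P^0_b$, $b\ne\gamma_0$, are not prescribed; all switches in those columns of layer 1 are open.) Single-memristor writing controller for $(\ell,k,j)$ (time measured from the start of the phase): fix a path $\gamma$ to the $(k,j)$-th memristor in layer $\ell$, use the switch settings corresponding to $\gamma$, and fix $x\ne0$, $\alpha>0$, $T>0$. Write $\phi_\gamma^\ell=\varphi^\ell_{kj}$, $\bar J_\gamma^\kappa=\bar J^\kappa_{\gamma_\kappa}$, $P_\gamma^0=P^0_{\gamma_0}$, $\hat W^\ell=W^\ell_{d,kj}$. Apply $P_\gamma^0(t)=x$ for $t\in[0,T]$. Then for $i=1,2,\dots$: form $m_i:=\bar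 J_\gamma^\ell(iT)/\sigma(\bar J_\gamma^{\ell-1}(iT))$ (this equals $W(\phi_\gamma^\ell(iT))$; for $\ell=1$ the denominator is read as $P_\gamma^0(iT)$). If $|\hat W^\ell-m_i|\le\epsilon$, stop; otherwise apply the constant input $P_\gamma^0(t)=\alpha(\hat W^\ell-m_i)$ for $t\in(iT,(i+1)T]$ and continue with $i+1$. Full writing procedure: process all memristors $(\ell,k,j)$ one at a time, in consecutive phases, in the order of the nested loops $\ell=L,L-1,\dots,1$; $j=1,\dots,n_{\ell-1}$; $k=1,\dots,n_\ell$. Each phase starts from the flux values present at the end of the preceding phase (initially $\varphi_0^1,\dots,\varphi_0^L$). In the phase of $(\ell,k,j)$, fix any path $\gamma$ to that memristor, choose $\alpha>0$ and $T>0$ with $T\alpha\le\frac{1}{\beta(\eta W_{\max})^{\ell-1}}$, and run the single-memristor writing controller; the phase is ended at a time $\hat T^\ell_{kj}\ge0$ at which $|\hat W^\ell-W(\phi_\gamma^\ell(\hat T^\ell_{kj}))|\le\epsilon$ (the termination criterion). *)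

(* Defs.v *)
From HB Require Import structures.
Set Warnings "-notation-overridden,-notation-incompatible-prefix".
From mathcomp Require Import all_boot all_order all_algebra.
From mathcomp Require Import all_classical all_reals all_analysis.
Set Implicit Arguments.
Unset Strict Implicit.
Unset Printing Implicit Defensive.
Import Order.TTheory GRing.Theory Num.Theory.
Import numFieldNormedType.Exports.
Local Open Scope classical_set_scope.
Local Open Scope ring_scope.

(* Layers are counted from 0: the index l < L stands for layer l+1, which sits
   between potentials of size n l and n l.+1. Families indexed by all l : nat
   are only ever constrained at l < L. *)

Section Devices.
Variable R : realType.
Implicit Types f sigma g W : R -> R.

Definition C1 f : Prop := (forall x, derivable f x 1) /\ continuous (derive1 f).

Definition strictly_monotone f : Prop :=
  forall x y, x != y -> 0 < (f x - f y) * (x - y).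

Record activation (eta : R) sigma : Prop := Activation {
  activation_C1 : C1 sigma;
  activation_odd : forall x, sigma (- x) = - sigma x;
  activation_mono : strictly_monotone sigma;
  activation_lip_gt0 : 0 < eta;
  activation_lip : eta.-lipschitz sigma }.

Record memristive (beta Wmin Wmax : R) g : Prop := Memristive {
  memristive_C1 : C1 g;
  memristive_gt0 : forall x, 0 < derive1 g x;
  memristive_mono : strictly_monotone (derive1 g);
  memristive_lip_gt0 : 0 < beta;
  memristive_lip : beta.-lipschitz (derive1 g);
  memristive_Wmin_gt0 : 0 < Wmin;
  memristive_Wmin_le_Wmax : Wmin <= Wmax;
  memristive_bounds : forall x, Wmin <= derive1 g x <= Wmax }.

Definition realizable W p q : set 'M[R]_(p, q) :=
  [set X | (forall i j, 0 < X i j) /\ exists phi, X = map_mx W phi].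

End Devices.

Section Circuit.
Variables (R : realType) (L : nat) (n : nat -> nat) (sigma W : R -> R).

Definition fluxes := forall l, 'M[R]_(n l.+1, n l).
Definition switches := forall l, 'M[bool]_(n l.+1, n l).

Definition hadamard p q (A B : 'M[R]_(p, q)) : 'M[R]_(p, q) :=
  map2_mx *%R A B.

Definition switch_mx p q (S : 'M[bool]_(p, q)) : 'M[R]_(p, q) :=
  map_mx (fun b : bool => b%:R) S.

Definition current (phi : fluxes) (S : switches) l (P : 'cV[R]_(n l)) :
    'cV[R]_(n l.+1) :=
  hadamard (map_mx W (phi l)) (switch_mx (S l)) *m P.

Fixpoint potential (phi : fluxes) (S : switches) (P0 : 'cV[R]_(n 0%N)) l :
    'cV[R]_(n l) :=
  match l return 'cV[R]_(n l) with
  | 0 => P0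
  | l'.+1 => map_mx sigma (current phi S (potential phi S P0 l'))
  end.

Definition flux_rate (phi : fluxes) (S : switches) (P0 : 'cV[R]_(n 0%N)) l :
    'M[R]_(n l.+1, n l) :=
  hadamard (switch_mx (S l)) (const_mx 1 *m (potential phi S P0 l)^T).

(* Integrated form of the flux equations, on a time domain D that is meant to
   be an interval starting at 0. *)
Definition solves_circuit (D : set R) (phi : R -> fluxes) (S : R -> switches)
    (P0 : R -> 'cV[R]_(n 0%N)) : Prop :=
  forall t, D t -> forall l, (l < L)%N -> forall a b,
    let rate s := flux_rate (phi s) (S s) (P0 s) l a b in
    lebesgue_measure.-integrable `[0, t] (EFin \o rate) /\
    phi t l a b =
      phi 0 l a b + \int[lebesgue_measure]_(s in `[0, t]) rate s.

Definition same_fluxes (phi psi : fluxes) : Prop :=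
  forall l, (l < L)%N -> phi l = psi l.

Definition memristor := {l : 'I_L & ('I_(n l.+1) * 'I_(n l))%type}.

Definition site (l : 'I_L) (k : 'I_(n l.+1)) (j : 'I_(n l)) : memristor :=
  @Tagged _ l (fun l : 'I_L => ('I_(n l.+1) * 'I_(n l))%type) (k, j).

Definition layer (m : memristor) : 'I_L := tag m.
Definition row_of (m : memristor) : 'I_(n (layer m).+1) := (tagged m).1.
Definition col_of (m : memristor) : 'I_(n (layer m)) := (tagged m).2.

(* The nested loops: layers downwards, then j, then k innermost. *)
Definition writing_order : seq memristor :=
  flatten [seq [seq @site l k j | j <- enum 'I_(n l), k <- enum 'I_(n l.+1)]
          | l <- rev (enum 'I_L)].

(* [route] holds the node chosen in each stage of a path, as a natural number;
   its values beyond the layer of the memristor are irrelevant. *)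
Record tuning := Tuning {
  route : nat -> nat;
  probe : R;
  gain : R;
  period : R }.

Definition is_path (m : memristor) (gamma : nat -> nat) : Prop :=
  [/\ forall c, (c <= (layer m).+1)%N -> (gamma c < n c)%N,
      gamma (layer m) = col_of m & gamma (layer m).+1 = row_of m].

Definition admissible (beta eta Wmax : R) (m : memristor) (c : tuning) : Prop :=
  [/\ is_path m (route c), probe c != 0, 0 < gain c, 0 < period c &
      period c * gain c <= 1 / (beta * (eta * Wmax) ^+ layer m)].

Definition switched_along (m : memristor) (gamma : nat -> nat) (S : switches) :
    Prop :=
  forall l, (l < L)%N -> forall a b,
    ((l <= layer m)%N ->
      S l a b = (a == gamma l.+1 :> nat) && (b == gamma l :> nat)) /\
    (l = (layer m).+1 -> S l a b = false).

Section Controller.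
Variables (eps : R) (Wd : forall l, 'M[R]_(n l.+1, n l)).
Variables (m : memristor) (c : tuning).
Variables (phi : R -> fluxes) (S : R -> switches) (P0 : R -> 'cV[R]_(n 0%N)).

Definition target : R := Wd (layer m) (row_of m) (col_of m).

Definition sample (i : nat) : R := i%:R * period c.

(* The denominator is sigma of the preceding current when [layer m] is
   positive, and the input itself when it is 0. *)
Definition measured (i : nat) : R :=
  let t := sample i in
  let P := potential (phi t) (S t) (P0 t) (layer m) in
  current (phi t) (S t) P (row_of m) 0 / P (col_of m) 0.

Definition stops_at (i : nat) : Prop := `|target - measured i| <= eps.

(* The closed loop on the time domain D. Once the controller has stopped, it
   no longer prescribes the input. *)
Record controlled (D : set R) : Prop := Controlled {
  controlled_circuit : solves_circuit D phi S P0;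
  controlled_switches : forall t, D t -> switched_along m (route c) (S t);
  controlled_probe : forall t, D t -> 0 <= t <= period c ->
    forall b : 'I_(n 0%N), b = route c 0 :> nat -> P0 t b 0 = probe c;
  controlled_feedback : forall i t, (0 < i)%N -> D t ->
    sample i < t <= sample i.+1 ->
    (forall i', (0 < i' <= i)%N -> ~ stops_at i') ->
    forall b : 'I_(n 0%N), b = route c 0 :> nat ->
      P0 t b 0 = gain c * (target - measured i) }.

(* The phase may be ended at time [tau]: the controller has not stopped
   earlier, and the termination criterion holds. *)
Definition ends_at (tau : R) : Prop :=
  [/\ 0 <= tau,
      forall i, (0 < i)%N -> sample i < tau -> ~ stops_at i &
      `|target - W (phi tau (layer m) (row_of m) (col_of m))| <= eps].

End Controller.

(* [flux] is a function of the total time elapsed; the switch and input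
   signals of each phase are functions of the time since its start. *)
Record run := Run {
  flux : R -> fluxes;
  duration : memristor -> R;
  tuned : memristor -> tuning;
  switch : memristor -> R -> switches;
  input : memristor -> R -> 'cV[R]_(n 0%N) }.

Definition start (r : run) (m : memristor) : R :=
  \sum_(m' <- take (index m writing_order) writing_order) duration r m'.

Definition phase_flux (r : run) (m : memristor) : R -> fluxes :=
  fun t => flux r (start r m + t).

Section Procedure.
Variables (beta eta Wmax eps : R) (Wd : forall l, 'M[R]_(n l.+1, n l)).

Definition phase_completed (r : run) (m : memristor) : Prop :=
  let c := tuned r m in
  let phi := phase_flux r m in
  [/\ admissible beta eta Wmax m c,
      controlled eps Wd m c phi (switch r m) (input r m) `[0, duration r m] &
      ends_at eps Wd m c phi (switch r m) (input r m) (duration r m)].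

(* The first p phases of r have been carried out, starting from phi0. *)
Definition completed (phi0 : fluxes) (r : run) (p : nat) : Prop :=
  same_fluxes (flux r 0) phi0 /\
  forall m : memristor, (index m writing_order < p)%N -> phase_completed r m.

End Procedure.
End Circuit.

(* Main.v *)
Require Import Defs.
From HB Require Import structures.
From mathcomp Require Import all_boot all_order all_algebra.
From mathcomp Require Import all_classical all_reals all_analysis.
From mathcomp Require Import measurable_realfun.
From mathcomp Require Import ring lra zify.
Set Implicit Arguments.
Unset Strict Implicit.
Unset Printing Implicit Defensive.
Import Order.TTheory GRing.Theory Num.Theory.
Import numFieldNormedType.Exports.
Local Open Scope classical_set_scope.
Local Open Scope ring_scope.

(** With the switches of a path closed, the circuit is a chain of single
    devices. The flux of a device does not influence the potential that drives
    it, so the flux equations of the chain are triangular and are solved layer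
    by layer by integration in time ([response]); no theory of differential
    equations is involved. The only loop is the feedback of the samples, and it
    is causal: the input held in a period depends on the fluxes at its
    beginning. A causal operator on sequences has a fixed point
    ([causal_fixpoint]), and so the closed loop exists ([phase_feasible]).

    As long as the controller has not stopped, its input is nonzero, and since
    an odd strictly increasing activation preserves signs, so is every
    potential along the path; the measured quotient is then the memductance
    itself ([measured_correct]). Over one period the flux of the target moves in
    the direction of the error. It moves so little that, by the Lipschitz
    bounds of activation and memductance and the step-size condition, the error
    cannot change its sign; and as long as the error exceeds the tolerance, it
    moves by at least a fixed amount, found by giving every device on the path
    its least memductance ([path_signal_ge]). A flux at which the desired
    memductance is attained lies ahead at a finite distance, so there are
    finitely many periods before the stop ([feedback_reaches],
    [phase_terminates]).

    Written values survive. In the phase of a device of some layer, the next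
    layer is open, so everything behind it is idle, and in the layer of the
    target only the target itself is driven ([flux_off_path]). As the layers
    are processed downwards and each device once, a device that has been
    written is never driven again ([written_persists]). *)

(** * Integrals over initial segments of the time axis *)

Section InitialSegments.
Variable R : realType.
Notation mu := (@lebesgue_measure R).
Implicit Types (a b c C M t : R) (f : R -> R).

(** The class of signals met along a path: it is stable under the two
    operations performed by a layer, integration in time and composition with
    continuous functions. *)
Definition regular_until b f : Prop :=
  measurable_fun (`[0, b] : set R) f /\
  exists M, forall t, 0 <= t <= b -> `|f t| <= M.

Lemma regular_integrable b f : regular_until b f ->
  mu.-integrable `[0, b] (EFin \o f).
Proof.
move=> [mf [M fM]]; apply: measurable_bounded_integrable => //.
  by rewrite /= lebesgue_measure_itv/=; case: ifP => _; rewrite ?ltry.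
exists M; split; first exact: num_real.
move=> M' MM' t /=; rewrite in_itv/= => tb.
exact: le_trans (fM t tb) (ltW MM').
Qed.

Lemma primitive_measurable b f : mu.-integrable `[0, b] (EFin \o f) ->
  measurable_fun (`[0, b] : set R) (fun t => \int[mu]_(s in `[0, t]) f s).
Proof.
move=> intf; have [b0|b0] := leP 0 b; last first.
  rewrite (_ : `[0, b]%classic = set0); first exact: measurable_fun_set0.
  by apply: set_itv_ge; rewrite bnd_simp -ltNge.
apply: subspace_continuous_measurable_fun => //.
exact: parameterized_integral_continuous.
Qed.

Lemma increment_bounds a b c C f : 0 <= a <= b ->
  mu.-integrable `[0, b] (EFin \o f) ->
  (forall t, a < t <= b -> c <= f t <= C) ->
  c * (b - a) <=
    \int[mu]_(s in `[0, b]) f s - \int[mu]_(s in `[0, a]) f s <=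
  C * (b - a).
Proof.
move=> /andP[a0 ab] intf fcC.
rewrite Rintegral_itvB ?bnd_simp//.
have sub h : mu.-integrable `[0, b] (EFin \o h) ->
    mu.-integrable `]a, b] (EFin \o h).
  by apply: integrableS => //; apply: subset_itvr; rewrite bnd_simp.
have muab : fine (mu `]a, b]) = b - a.
  rewrite lebesgue_measure_itv/= lte_fin; case: ltP => //= ba.
  by apply/esym/eqP; rewrite subr_eq0 eq_le ab ba.
have intk k : mu.-integrable `]a, b] (EFin \o (fun=> k : R)).
  apply/sub/regular_integrable; split; first exact: measurable_cst.
  by exists `|k|.
have intab := sub _ intf.
by rewrite -!muab -!Rintegral_cst//; apply/andP; split; apply: le_Rintegral;
  rewrite // => t /=; rewrite in_itv/= => /fcC /andP[].
Qed.

End InitialSegments.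

(** * Signals along a path *)

Section PathSignal.
Variables (R : realType) (sigma W : R -> R) (eta Wmin Wmax : R).
Hypotheses (sigma_act : activation eta sigma) (Wmin_gt0 : 0 < Wmin)
  (Wbounds : forall x, Wmin <= W x <= Wmax).
Notation mu := (@lebesgue_measure R).
Implicit Types (x : R) (w : nat -> R).

(** A chain of single devices of memductances [w], fed with [u]: this is what
    the circuit reduces to when only the switches of a path are closed. *)
Fixpoint path_signal w (u : R) l : R :=
  if l is l'.+1 then sigma (w l' * path_signal w u l') else u.

Lemma eq_path_signal w w' u l : (forall i, (i < l)%N -> w i = w' i) ->
  path_signal w u l = path_signal w' u l.
Proof.
elim: l => //= l IH ww'; rewrite ww'// IH// => i il.
exact/ww'/ltnW.
Qed.

Lemma activation0 : sigma 0 = 0.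
Proof. by have := activation_odd sigma_act 0; rewrite oppr0; lra. Qed.

Lemma activation_gt0 x : 0 < x -> 0 < sigma x.
Proof.
move=> x0; have := activation_mono sigma_act (lt0r_neq0 x0).
by rewrite activation0 !subr0 pmulr_lgt0.
Qed.

Lemma activation_incr x y : x <= y -> sigma x <= sigma y.
Proof.
rewrite le_eqVlt => /predU1P[->//|xy].
have := activation_mono sigma_act (negbT (gt_eqF xy)).
by rewrite pmulr_lgt0 ?subr_gt0// => /ltW.
Qed.

Lemma activation_le x : `|sigma x| <= eta * `|x|.
Proof.
have /= := activation_lip sigma_act (x := (x, 0)) (conj I I).
by rewrite activation0 !subr0.
Qed.

Lemma activation_continuous : continuous sigma.
Proof.
move=> x; apply/differentiable_continuous/derivable1_diffP.
by have [+ _] := activation_C1 sigma_act; apply.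
Qed.

Lemma Wmax_gt0 : 0 < Wmax.
Proof. by have /andP[a b] := Wbounds 0; exact: lt_le_trans (le_trans a b). Qed.

Lemma path_signalN w u l : path_signal w (- u) l = - path_signal w u l.
Proof.
elim: l => //= l ->.
by rewrite mulrN (activation_odd sigma_act).
Qed.

Lemma path_signal_le w u l : (forall i, Wmin <= w i <= Wmax) ->
  `|path_signal w u l| <= (eta * Wmax) ^+ l * `|u|.
Proof.
move=> wb; elim: l => [|l IH] /=; first by rewrite expr0 mul1r.
apply: le_trans (activation_le _) _.
have eta0 := activation_lip_gt0 sigma_act.
rewrite exprS -!mulrA ler_pM2l// normrM.
have /andP[w1 w2] := wb l.
have w0 : 0 < w l by exact: lt_le_trans w1.
rewrite gtr0_norm//; apply: ler_pM => //; exact: ltW.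
Qed.

(** By monotony of the activation the attenuation is largest when all devices
    have the least memductance, which gives a bound independent of the
    state. *)
Lemma path_signal_ge w a u l : (forall i, Wmin <= w i <= Wmax) ->
  0 < a <= u ->
  0 < path_signal (fun=> Wmin) a l <= path_signal w u l.
Proof.
move=> wb au; elim: l => [//|l /= /andP[IH1 IH2]].
rewrite activation_gt0 ?mulr_gt0//=; apply: activation_incr.
by apply: ler_pM => //; [exact: ltW|exact: ltW|case/andP: (wb l)].
Qed.

Lemma path_signal_neq0 w u l : (forall i, Wmin <= w i <= Wmax) ->
  u != 0 -> path_signal w u l != 0.
Proof.
move=> wb; have pos v : 0 < v -> 0 < path_signal w v l.
  move=> v0; have vv : 0 < v <= v by rewrite v0 lexx.
  by have /andP[] := path_signal_ge l wb vv; exact: lt_le_trans.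
rewrite neq_lt => /orP[u0|/pos/lt0r_neq0//].
by rewrite -(opprK u) path_signalN oppr_eq0 lt0r_neq0// pos// oppr_gt0.
Qed.

(** * Response of a path to a given input *)

(** The flux equations along a path are triangular, since the flux of a device
    does not influence the potential that drives it. They are therefore solved
    layer by layer by plain integration. *)
Fixpoint response (y : nat -> R) (u : R -> R) l : R -> R :=
  if l is l'.+1 then
    fun t => sigma (W (y l' + \int[mu]_(s in `[0, t]) response y u l' s)
                    * response y u l' t)
  else u.

Definition response_flux y u l t : R :=
  y l + \int[mu]_(s in `[0, t]) response y u l s.

Lemma responseE y u l t :
  response y u l t = path_signal (fun i => W (response_flux y u i t)) (u t) l.
Proof. by elim: l => //= l <-. Qed.

Lemma response_regular y u l b : continuous W ->
  regular_until b u -> regular_until b (response y u l).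
Proof.
move=> Wc ur; elim: l => //= l [IHm [M IHb]]; split.
  apply: measurableT_comp.
    by apply: continuous_measurable_fun; exact: activation_continuous.
  apply: measurable_funM => //.
  apply: measurableT_comp; first exact: continuous_measurable_fun.
  apply: measurable_funD; first exact: measurable_cst.
  apply: primitive_measurable; apply: regular_integrable.
  by split=> //; exists M.
exists (eta * (Wmax * M)) => t tb.
apply: le_trans (activation_le _) _.
rewrite ler_pM2l ?(activation_lip_gt0 sigma_act)// normrM.
set x := W _; have /andP[w1 w2] : Wmin <= x <= Wmax by exact: Wbounds.
have x0 : 0 < x by exact: lt_le_trans w1.
by rewrite gtr0_norm//; apply: ler_pM => //; [exact: ltW|exact: IHb].
Qed.

Lemma response_causal y u v b l :
  (forall t, 0 <= t <= b -> u t = v t) ->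
  forall t, 0 <= t <= b -> response y u l t = response y v l t.
Proof.
move=> uv; elim: l => //= l IH t tb; rewrite IH//.
congr (sigma (W (_ + _) * _)).
apply: eq_Rintegral => s; rewrite inE/= in_itv/= => /andP[s0 st].
by apply: IH; rewrite s0 (le_trans st)//; case/andP: tb.
Qed.

End PathSignal.
(** * Piecewise constant inputs *)

Section SampledInput.
Variables (R : realType) (T : R).
Hypothesis T_gt0 : 0 < T.
Implicit Types (t : R) (v : nat -> R).

(** The [i] with [t] in the half-open period from [i%:R * T] (excluded) to
    [i.+1%:R * T]; the instant 0 is counted in the first period. *)
Definition period_index t : nat := `|Num.ceil (t / T)|%N.-1.

Definition hold v t : R := v (period_index t).

Lemma period_index_le t k : 0 <= t ->
  (period_index t <= k)%N = (t <= k.+1%:R * T).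
Proof.
move=> t0; rewrite -ler_pdivrMr// -[k.+1%:R]/(k.+1%:Z%:~R) -ceil_le_int.
have : 0 <= Num.ceil (t / T).
  by rewrite ceil_ge0 (@lt_le_trans _ _ 0)// divr_ge0// ltW.
rewrite /period_index; case: (Num.ceil _) => // c _.
by rewrite lez_nat absz_nat; lia.
Qed.

Lemma period_indexE t i : i%:R * T < t <= i.+1%:R * T -> period_index t = i.
Proof.
move=> /andP[it ti]; have t0 : 0 <= t.
  by apply: le_trans (ltW it); rewrite mulr_ge0// ltW.
apply/eqP; rewrite eqn_leq period_index_le// ti/=.
case: i it ti => // i it _.
by rewrite ltnNge period_index_le// -ltNge.
Qed.

Lemma period_index0 t : 0 <= t <= T -> period_index t = 0%N.
Proof.
move=> /andP[t0 tT]; apply/eqP; rewrite -leqn0 period_index_le//.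
by rewrite mul1r.
Qed.

Lemma hold_regular v b : regular_until b (hold v).
Proof.
split=> [mD Y mY|].
  have -> : `[0, b] `&` hold v @^-1` Y =
      \bigcup_(i in [set i | Y (v i)]) (`[0, b] `&`
        (`]-oo, i.+1%:R * T] `\`
          (if i is j.+1 then `]-oo, j.+1%:R * T] else set0))).
    apply/seteqP; split=> [t [/= tb Yt]|t [i /= Yi [/= tb [ti nti]]]].
      exists (period_index t) => //; split=> //=.
      move: (tb); rewrite in_itv/= => /andP[t0 _]; split.
        by rewrite in_itv/= -period_index_le.
      case E: (period_index t) => [|j]//=.
      by rewrite in_itv/= -period_index_le// E ltnn.
    split=> //; move: tb; rewrite in_itv/= => /andP[t0 _].
    suff -> : hold v t = v i by [].
    congr v; apply/eqP; move: ti nti; rewrite in_itv/= -period_index_le// => ti.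
    rewrite eqn_leq ti/=; case: i {Yi} ti => // i _.
    by rewrite /= in_itv/= -period_index_le// => /negP; rewrite -ltnNge.
  apply: bigcup_measurable => -[|i] _; apply: measurableI => //;
    by apply: measurableD => //; exact: measurable_itv.
have [N bN] : exists N : nat, b <= N.+1%:R * T.
  exists (Num.trunc (b / T)); rewrite -ler_pdivrMr//.
  exact/ltW/truncnS_gt.
exists (\sum_(i < N.+1) `|v i|) => t /andP[t0 tb].
have tN : (period_index t < N.+1)%N.
  by rewrite ltnS period_index_le// (le_trans tb).
rewrite (bigD1 (Ordinal tN))//= lerDl.
by apply: sumr_ge0 => i _; exact: normr_ge0.
Qed.

End SampledInput.

(** A causal operator on sequences has a fixed point: the [i]th entry is
    settled after [i.+1] iterations. *)
Lemma causal_fixpoint (T : Type) (F : (nat -> T) -> nat -> T) (v0 : nat -> T) :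
  (forall i v w, (forall j, (j < i)%N -> v j = w j) -> F v i = F w i) ->
  exists v, forall i, v i = F v i.
Proof.
move=> Fc.
have stable i : forall p q, (i < p)%N -> (i < q)%N ->
    iter p F v0 i = iter q F v0 i.
  elim/ltn_ind: i => i IH [//|p] [//|q] ip iq.
  by apply: Fc => j ji; apply: IH => //; exact: leq_trans ji _.
exists (fun i => iter i.+1 F v0 i) => i.
by rewrite [LHS]/=; apply: Fc => j ji; exact: stable.
Qed.

(** * Convergence of the sampled feedback *)

(** The sampled error cannot change its sign, because the Lipschitz bound makes
    a step at most as long as the way to the target; and as long as the error
    exceeds [eps], each step has at least the length [c], so that a fixed level
    at which the target is attained would be passed after finitely many
    steps. *)
Lemma feedback_reaches (R : realType) (W : R -> R) (beta eps c y xd : R)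
    (x : nat -> R) :
  strictly_monotone W -> beta.-lipschitz W -> 0 < beta -> 0 < eps -> 0 < c ->
  W xd = y ->
  (forall i, eps < `|y - W (x i)| ->
    [/\ 0 <= (x i.+1 - x i) * (y - W (x i)),
        beta * `|x i.+1 - x i| <= `|y - W (x i)| & c <= `|x i.+1 - x i|]) ->
  exists i, `|y - W (x i)| <= eps.
Proof.
move=> Wmono Wlip beta0 eps0 c0 Wxd step; apply/not_existsP => never.
have far i : eps < `|y - W (x i)| by rewrite ltNge; apply/negP/never.
have side i s : s = 1 \/ s = -1 -> 0 < s * (y - W (x i)) -> 0 < s * (xd - x i).
  move=> s1 ei; have xne : xd != x i.
    by apply: contraTneq ei => <-; rewrite Wxd subrr mulr0 ltxx.
  have := Wmono _ _ xne; rewrite Wxd => h.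
  by case: s1 ei => ->; nra.
(* [s] is the sign of the initial error, shown in [inv] to be kept. *)
have [s [s1 s0]] : exists s, (s = 1 \/ s = -1) /\ 0 < s * (y - W (x 0%N)).
  have := far 0%N; case: (ltrP 0 (y - W (x 0%N))) => h.
    by exists 1; rewrite mul1r; auto.
  move=> fr; exists (-1); rewrite mulN1r oppr_gt0; split; [by right|].
  rewrite lt_neqAle h andbT; apply: contraTneq fr => ->.
  by rewrite normr0 -leNgt ltW.
have inv i : 0 < s * (y - W (x i)) /\
    s * (xd - x i) <= s * (xd - x 0%N) - i%:R * c.
  elim: i => [|i [IH1 IH2]]; first by rewrite mul0r subr0.
  have [d1 d2 d3] := step i (far i).
  have := Wlip (x i.+1, x i) (conj I I) => /= lipi.
  have far1 := far i.+1.
  move: (far i) d1 d2 d3 lipi far1 IH1 IH2; rewrite -[i.+1%:R]natr1.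
  set e := y - W (x i); set d := x i.+1 - x i.
  move=> fari d1 d2 d3 lipi far1 IH1 IH2.
  have We : y - W (x i.+1) = e - (W (x i.+1) - W (x i)) by rewrite /e; lra.
  have dE : xd - x i.+1 = xd - x i - d by rewrite /d; lra.
  move: far1; rewrite We dE; move: (W (x i.+1) - W (x i)) lipi => z lipi far1.
  have zle : `|z| <= `|e| by exact: le_trans d2.
  case: s1 IH1 IH2 => ->; rewrite ?mul1r ?mulN1r => IH1 IH2; split.
  - move: zle; rewrite (gtr0_norm IH1) ler_norml => /andP[z1 z2].
    rewrite lt_neqAle subr_ge0 z2 andbT eq_sym; apply: contraTneq far1 => ->.
    by rewrite normr0 -leNgt ltW.
  - have d0 : 0 <= d by move: d1; rewrite pmulr_lge0.
    by move: d3; rewrite ger0_norm//; lra.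
  - move: IH1; rewrite oppr_gt0 => IH1.
    move: zle; rewrite (ltr0_norm IH1) ler_norml => /andP[z1 z2].
    rewrite oppr_gt0 lt_neqAle; apply/andP; split; last by lra.
    by apply: contraTneq far1 => ->; rewrite normr0 -leNgt ltW.
  - move: IH1; rewrite oppr_gt0 => IH1.
    have d0 : d <= 0 by move: d1; rewrite nmulr_lge0.
    by move: d3; rewrite ler0_norm//; lra.
(* After [k] steps the level [xd] would have been passed. *)
pose k := (Num.trunc (s * (xd - x 0%N) / c)).+1.
have : s * (xd - x 0%N) / c < k%:R by exact: truncnS_gt.
rewrite ltr_pdivrMr// => kc.
have [/(side k s s1) h1 h2] := inv k.
by have := lt_le_trans h1 h2; rewrite subr_gt0 ltNge (ltW kc).
Qed.

(** * The circuit with the switches set along a path *)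

Section Phase.
Variables (R : realType) (L : nat) (n : nat -> nat) (sigma W : R -> R).
Variables (eta Wmin Wmax : R).
Hypotheses (sigma_act : activation eta sigma)
  (Wbounds : forall x, Wmin <= W x <= Wmax).
Notation mu := (@lebesgue_measure R).
Implicit Types (phi : fluxes R n) (S : switches n) (m : memristor L n).
Implicit Types (gamma : nat -> nat).

Lemma currentE phi S l (P : 'cV[R]_(n l)) a :
  current W phi S P a 0 = \sum_b W (phi l a b) * (S l a b)%:R * P b 0.
Proof. by rewrite mxE; apply: eq_bigr => b _; rewrite !mxE. Qed.

Lemma flux_rateE phi S P0 l a b :
  flux_rate sigma W phi S P0 l a b =
  (S l a b)%:R * potential sigma W phi S P0 l b 0.
Proof. by rewrite !mxE big_ord1 !mxE mul1r. Qed.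

(** The flux of the device between the nodes [gamma l] and [gamma l.+1]; the
    default 0 is only reached for nodes out of range. *)
Definition path_flux phi gamma l : R :=
  if (insub (gamma l.+1), insub (gamma l)) is (Some a, Some b) then phi l a b
  else 0.

Lemma path_fluxE phi gamma l (a : 'I_(n l.+1)) (b : 'I_(n l)) :
  a = gamma l.+1 :> nat -> b = gamma l :> nat ->
  path_flux phi gamma l = phi l a b.
Proof. by rewrite /path_flux => <- <-; rewrite !valK. Qed.

Definition path_weight phi gamma l : R := W (path_flux phi gamma l).

Lemma path_weight_bounds phi gamma l : Wmin <= path_weight phi gamma l <= Wmax.
Proof. exact: Wbounds. Qed.

Definition on_path m gamma l (a b : nat) : bool :=
  [&& (l <= layer m)%N, a == gamma l.+1 & b == gamma l].

Section SwitchedAlong.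
Variables (m : memristor L n) (gamma : nat -> nat) (phi : fluxes R n)
  (S : switches n) (P0 : 'cV[R]_(n 0%N)) (u : R).
Hypotheses (gamma_path : is_path m gamma) (S_gamma : switched_along m gamma S)
  (P0u : forall b : 'I_(n 0%N), b = gamma 0%N :> nat -> P0 b 0 = u).

Lemma node_on_path l : (l <= (layer m).+1)%N ->
  exists b : 'I_(n l), b = gamma l :> nat.
Proof. by case: gamma_path => h _ _ /h hl; exists (Ordinal hl). Qed.

Lemma current_on_path l (P : 'cV[R]_(n l)) (a : 'I_(n l.+1)) (b : 'I_(n l)) :
  (l <= layer m)%N -> a = gamma l.+1 :> nat -> b = gamma l :> nat ->
  current W phi S P a 0 = path_weight phi gamma l * P b 0.
Proof.
move=> lm ag bg; have lL := leq_ltn_trans lm (ltn_ord (layer m)).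
have SE := fun b' => (S_gamma lL a b').1 lm.
rewrite currentE (bigD1 b)//= big1 ?addr0 => [|b' b'b].
  by rewrite SE -ag -bg !eqxx mulr1 /path_weight (path_fluxE _ ag bg).
by rewrite SE -bg ag eqxx (inj_eq val_inj) (negbTE b'b) mulr0 mul0r.
Qed.

Lemma potential_on_path l (b : 'I_(n l)) :
  (l <= layer m)%N -> b = gamma l :> nat ->
  potential sigma W phi S P0 l b 0 =
  path_signal sigma (path_weight phi gamma) u l.
Proof.
elim: l b => [|l IH] b lm bg /=; first exact: P0u.
have [b' b'g] := node_on_path (leqW (ltnW lm)).
by rewrite mxE (current_on_path _ (ltnW lm) bg b'g) IH// ltnW.
Qed.

(** The open layer behind the target stops every signal, and the activation
    maps 0 to 0; so the later layers stay idle whatever their switches. *)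
Lemma potential_behind_target l b : ((layer m).+1 < l)%N -> (l <= L)%N ->
  potential sigma W phi S P0 l b 0 = 0.
Proof.
elim: l b => [//|l IH] b ml lL /=.
rewrite mxE currentE big1 ?(activation0 sigma_act)// => b' _.
move: ml; rewrite ltnS leq_eqVlt => /predU1P[ml|ml]; last first.
  by rewrite IH ?mulr0// ltnW.
by rewrite (S_gamma lL b b').2// mulr0 mul0r.
Qed.

Lemma flux_rate_on_path l a b : (l < L)%N ->
  flux_rate sigma W phi S P0 l a b =
  if on_path m gamma l a b
  then path_signal sigma (path_weight phi gamma) u l else 0.
Proof.
move=> lL; rewrite flux_rateE /on_path; have [lm|] := leqP l (layer m).
  rewrite ((S_gamma lL a b).1 lm); case: eqP => [ag|_]; last by rewrite mul0r.
  case: eqP => [bg|_]; last by rewrite mul0r.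
  by rewrite mul1r (potential_on_path lm bg).
rewrite /= leq_eqVlt => /predU1P[/esym ml|ml].
  by rewrite (S_gamma lL a b).2// mul0r.
by rewrite (potential_behind_target b ml) ?mulr0// ltnW.
Qed.

End SwitchedAlong.

(** Off the path the flux rate vanishes identically, so the integrated
    equation gives exact constancy. A phase thus disturbs no layer behind its
    target and no other device in the layer of the target. *)
Lemma flux_off_path m gamma (D : set R) (phi : R -> fluxes R n)
    (S : R -> switches n) (P0 : R -> 'cV[R]_(n 0%N)) t l
    (a : 'I_(n l.+1)) (b : 'I_(n l)) :
  is_path m gamma ->
  solves_circuit L sigma W D phi S P0 ->
  (forall s, D s -> switched_along m gamma (S s)) ->
  (forall s, 0 <= s <= t -> D s) -> D t ->
  (l < L)%N -> ~~ on_path m gamma l a b ->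
  phi t l a b = phi 0 l a b.
Proof.
move=> gp sol sw Dt tD lL off.
have [_ ->] := sol t tD l lL a b.
rewrite (_ : Rintegral _ _ _ = 0) ?addr0//.
have /= := @eq_Rintegral _ _ _ mu `[0, t]%classic (fun=> 0 : R)
  (fun s => flux_rate sigma W (phi s) (S s) (P0 s) l a b).
move=> ->; first by rewrite Rintegral_cst// mul0r.
move=> s; rewrite inE/= in_itv/= => /Dt Ds.
have [b0 b0g] : exists b : 'I_(n 0%N), b = gamma 0%N :> nat.
  exact: (@node_on_path m).
rewrite (@flux_rate_on_path m gamma _ _ _ (P0 s b0 0))// ?(negbTE off)//.
  exact: sw.
by move=> b'; rewrite -b0g => /val_inj ->.
Qed.

End Phase.

(** * A single writing phase *)

Section WritingPhase.
Variables (R : realType) (L : nat) (n : nat -> nat) (sigma W : R -> R).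
Variables (eta beta Wmin Wmax eps : R) (Wd : forall l, 'M[R]_(n l.+1, n l)).
Hypotheses (sigma_act : activation eta sigma) (Wmin_gt0 : 0 < Wmin)
  (Wbounds : forall x, Wmin <= W x <= Wmax) (eps_gt0 : 0 < eps).
Notation mu := (@lebesgue_measure R).
Variables (m : memristor L n) (c : tuning R).
Hypothesis c_adm : admissible beta eta Wmax m c.

Let gamma_path : is_path m (route c). Proof. by case: c_adm. Qed.
Let period_gt0 : 0 < period c. Proof. by case: c_adm. Qed.
Let gain_gt0 : 0 < gain c. Proof. by case: c_adm. Qed.

Lemma layer_lt : (layer m < L)%N. Proof. exact: ltn_ord. Qed.

Lemma target_on_path : on_path m (route c) (layer m) (row_of m) (col_of m).
Proof. by rewrite /on_path; case: gamma_path => _ -> ->; rewrite leqnn !eqxx. Qed.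

Lemma sampleS i : sample c i.+1 - sample c i = period c.
Proof. by rewrite /sample -natr1; ring. Qed.

Lemma sample_lt i j : (sample c i < sample c j) = (i < j)%N.
Proof. by rewrite ltr_pM2r// ltr_nat. Qed.

Lemma sample_ge0 i : 0 <= sample c i.
Proof. by rewrite mulr_ge0// ltW. Qed.

Lemma measured_state (phi : R -> fluxes R n) (S : R -> switches n)
    (P0 : R -> 'cV[R]_(n 0%N)) i u :
  switched_along m (route c) (S (sample c i)) -> u != 0 ->
  (forall b : 'I_(n 0%N), b = route c 0%N :> nat -> P0 (sample c i) b 0 = u) ->
  measured sigma W m c phi S P0 i =
  W (phi (sample c i) (layer m) (row_of m) (col_of m)).
Proof.
move=> sw u0 uP; have [_ colE rowE] := gamma_path.
rewrite /measured (current_on_path _ _ sw _ _ (esym rowE) (esym colE))//.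
rewrite /path_weight (path_fluxE _ (esym rowE) (esym colE)) mulfK//.
rewrite (potential_on_path _ _ _ gamma_path sw uP)//.
exact: (path_signal_neq0 sigma_act Wmin_gt0 _ (path_weight_bounds Wbounds _ _)).
Qed.

Section Controlled.
Variables (phi : R -> fluxes R n) (S : R -> switches n).
Variables (P0 : R -> 'cV[R]_(n 0%N)) (D : set R).
Hypothesis ctrl : controlled sigma W eps Wd m c phi S P0 D.

Notation measured := (measured sigma W m c phi S P0).
Notation stops_at := (stops_at sigma W eps Wd m c phi S P0).
Notation state t := (phi t (layer m) (row_of m) (col_of m)).

(** The input held after the [i]th sample, where the start of the phase counts
    as the sample 0 and is followed by the probing period. *)
Definition command i : R :=
  if i is 0%N then probe c else gain c * (target Wd m - measured i).

Lemma input_command i t (b : 'I_(n 0%N)) : D t ->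
  sample c i < t <= sample c i.+1 ->
  (forall i', (0 < i' <= i)%N -> ~ stops_at i') ->
  b = route c 0%N :> nat -> P0 t b 0 = command i.
Proof.
case: i => [|i] Dt ti ns bE.
  apply: (controlled_probe ctrl) => //.
  by move: ti; rewrite /sample mul0r mul1r => /andP[/ltW -> ->].
exact: (controlled_feedback ctrl (i := i.+1)) ti ns b bE.
Qed.

Lemma command_neq0 i : ((0 < i)%N -> ~ stops_at i) -> command i != 0.
Proof.
case: i => [_|i /(_ isT)/negP]; first by case: c_adm.
rewrite -ltNge => ei; rewrite mulf_neq0 ?(lt0r_neq0 gain_gt0)//.
by rewrite -normr_gt0 (lt_trans eps_gt0).
Qed.

(** Before the stop the error exceeds [eps], so the last input held was
    nonzero, hence also the potential that reaches the device; dividing the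
    current by it gives the memductance. *)
Lemma measured_correct i : (0 < i)%N -> D (sample c i) ->
  (forall i', (0 < i' < i)%N -> ~ stops_at i') ->
  measured i = W (state (sample c i)).
Proof.
case: i => // i _ Di ns; apply: (@measured_state _ _ _ _ (command i)) => //.
  exact: (controlled_switches ctrl).
  by apply: command_neq0 => i0; apply: ns; rewrite i0/=.
by move=> b; apply: input_command => //; rewrite sample_lt ltnSn lexx.
Qed.

End Controlled.

(** ** Feasibility *)

Section Feasibility.

Hypothesis W_cont : continuous W.

(** The value to be held in a period depends on the flux at its beginning, which
    is determined by the values held before; so the closed loop is a causal
    fixed-point problem for the sequence of held values. *)
Lemma phase_feasible (phi0 : fluxes R n) (S : R -> switches n)
    (Q : R -> 'cV[R]_(n 0%N)) :
  (forall t, 0 <= t -> switched_along m (route c) (S t)) ->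
  exists (phi : R -> fluxes R n) (P0 : R -> 'cV[R]_(n 0%N)),
    [/\ phi 0 = phi0,
        forall t (b : 'I_(n 0%N)), b != route c 0%N :> nat ->
          P0 t b 0 = Q t b 0 &
        controlled sigma W eps Wd m c phi S P0 `[0, +oo[%classic].
Proof.
move=> sw; pose y := path_flux phi0 (route c).
pose input v := hold (period c) v.
pose x v l t := response_flux sigma W y (input v) l t.
pose F v i := if i is 0%N then probe c else
  gain c * (target Wd m - W (x v (layer m) (sample c i))).
have [v vF] : exists v, forall i, v i = F v i.
  apply: (causal_fixpoint (fun=> 0)) => -[//|i] v w vw.
  rewrite /F /x /response_flux; congr (_ * (_ - W (_ + _))).
  apply: eq_Rintegral => t; rewrite inE/= in_itv/= => ti.
  apply: response_causal ti => s /andP[s0 si].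
  by apply: vw; rewrite ltnS period_index_le.
pose u := input v.
pose phi t : fluxes R n := fun l => \matrix_(a, b)
  if on_path m (route c) l a b then x v l t else phi0 l a b.
pose P0 t : 'cV[R]_(n 0%N) :=
  \col_b if b == route c 0%N :> nat then u t else Q t b 0.
have P0E t (b : 'I_(n 0%N)) : b = route c 0%N :> nat -> P0 t b 0 = u t.
  by move=> bE; rewrite mxE bE eqxx.
have on_pathE l (a : 'I_(n l.+1)) (b : 'I_(n l)) : on_path m (route c) l a b ->
    a = route c l.+1 :> nat /\ b = route c l :> nat.
  by case/and3P => _ /eqP ? /eqP ?.
have pathE t l : (l <= layer m)%N -> path_flux (phi t) (route c) l = x v l t.
  move=> lm; have [a aE] := node_on_path gamma_path (l := l.+1) lm.
  have [b bE] := node_on_path gamma_path (leqW lm).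
  by rewrite (path_fluxE _ aE bE) mxE /on_path lm aE bE !eqxx.
have rateE t l a b : (l < L)%N -> 0 <= t ->
    flux_rate sigma W (phi t) (S t) (P0 t) l a b =
    if on_path m (route c) l a b then response sigma W y u l t else 0.
  move=> lL t0.
  rewrite (flux_rate_on_path _ sigma_act _ gamma_path (sw t t0) (P0E t))//.
  case: ifP => // /and3P[lm _ _]; rewrite responseE; apply: eq_path_signal.
  by move=> i il; rewrite /path_weight pathE// (leq_trans (ltnW il)).
have phi00 : phi 0 = phi0.
  apply: functional_extensionality_dep => l; apply/matrixP => a b; rewrite mxE.
  case: ifP => // /on_pathE [aE bE]; rewrite /x /response_flux set_itv1.
  by rewrite Rintegral_set1 addr0 /y (path_fluxE _ aE bE).
have u_reg b : regular_until b u by exact: hold_regular.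
exists phi, P0; split => //.
  by move=> t b /negbTE bE; rewrite mxE bE.
have ctrl_circuit : solves_circuit L sigma W `[0, +oo[%classic phi S P0.
  move=> t tD l lL a b rate; have t0 : 0 <= t.
    by move: tD; rewrite /= in_itv/= andbT.
  have resp_int : mu.-integrable `[0, t] (EFin \o response sigma W y u l).
    exact/regular_integrable/(response_regular sigma_act Wmin_gt0 Wbounds).
  rewrite phi00 mxE.
  have rE s : s \in `[0, t]%classic -> rate s =
      if on_path m (route c) l a b then response sigma W y u l s else 0.
    by rewrite inE/= in_itv/= => /andP[s0 _]; exact: rateE.
  split; last first.
    rewrite (@eq_Rintegral _ _ _ mu `[0, t]%classic _ rate rE).
    case: ifP => [/on_pathE[aE bE]|_].
      by rewrite /x /response_flux /y (path_fluxE _ aE bE).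
    by rewrite Rintegral_cst// mul0r addr0.
  apply: (@eq_integrable _ _ _ mu `[0, t]%classic _
    (fun s => (if on_path m (route c) l a b then response sigma W y u l s
               else 0)%:E) (EFin \o rate)) => //.
    by move=> s sI /=; rewrite rE.
  by case: (on_path m (route c) l a b) => //; exact: integrable0.
have holdE i t : sample c i < t <= sample c i.+1 -> u t = v i.
  by move=> ti; rewrite /u /input /hold (period_indexE period_gt0 ti).
have v_neq0 i :
    ((0 < i)%N -> ~ `|target Wd m - W (x v (layer m) (sample c i))| <= eps) ->
    v i != 0.
  case: i => [_|i /(_ isT)/negP]; rewrite vF/=; first by case: c_adm.
  rewrite -ltNge => ei; rewrite mulf_neq0 ?(lt0r_neq0 gain_gt0)//.
  by rewrite -normr_gt0 (lt_trans eps_gt0).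
have measuredE i : (0 < i)%N ->
    (forall i', (0 < i' < i)%N -> ~ stops_at sigma W eps Wd m c phi S P0 i') ->
    measured sigma W m c phi S P0 i = W (x v (layer m) (sample c i)).
  elim/ltn_ind: i => -[//|i] IH _ ns.
  rewrite (@measured_state _ _ _ _ (v i)); first by rewrite mxE target_on_path.
  - exact/sw/sample_ge0.
  - apply: v_neq0 => i0 st; apply: (ns i); first by rewrite i0/=.
    rewrite /stops_at IH// => i' /andP[i'0 i'i]; apply: ns; lia.
  - by move=> b /P0E ->; apply: holdE; rewrite sample_lt ltnSn lexx.
split=> //.
- by move=> t; rewrite /= in_itv/= andbT; exact: sw.
- by move=> t _ tT b /P0E ->; rewrite /u /input /hold period_index0// vF.
- move=> [//|i] t _ _ ti ns b /P0E ->; rewrite (holdE _ _ ti) vF/= measuredE//.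
  by move=> i' /andP[i'0 i'i]; apply: ns; rewrite i'0 ltnW.
Qed.

End Feasibility.

(** ** Termination *)

Variables (xd : R).
Hypotheses (W_mono : strictly_monotone W) (W_lip : beta.-lipschitz W)
  (beta_gt0 : 0 < beta)
  (W_xd : W xd = target Wd m).

(** The step-size condition as it is used: in one period, an error [e] changes
    the memductance by at most [`|e|]. *)
Lemma loop_gain_le1 :
  beta * ((eta * Wmax) ^+ layer m * gain c * period c) <= 1.
Proof.
have [_ _ _ _] := c_adm; rewrite ler_pdivlMr; first by rewrite mulrC; lra.
rewrite mulr_gt0// exprn_gt0// mulr_gt0// ?(activation_lip_gt0 sigma_act)//.
exact: Wmax_gt0 Wbounds.
Qed.

(** The rate of the target flux lies between two positive bounds in the
    direction of the error: [s0] from the least memductances and an error of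
    size [eps], and [s1] from the Lipschitz bounds. Integrated over a period,
    they are the hypotheses of [feedback_reaches]. *)
Lemma phase_terminates (phi : R -> fluxes R n) (S : R -> switches n)
    (P0 : R -> 'cV[R]_(n 0%N)) :
  controlled sigma W eps Wd m c phi S P0 `[0, +oo[%classic ->
  exists tau, ends_at sigma W eps Wd m c phi S P0 tau.
Proof.
move=> ctrl; pose D : set R := `[0, +oo[%classic.
have Dt t : 0 <= t -> D t by move=> t0; rewrite /D/= in_itv/= andbT.
have DS i : D (sample c i) by exact/Dt/sample_ge0.
have correct i := measured_correct ctrl (ltn0Sn i) (DS i.+1).
pose x i := phi (sample c i.+1) (layer m) (row_of m) (col_of m).
suff [k xk] : exists i, `|target Wd m - W (x i)| <= eps.
  have [k' xk' mink'] := ex_minnP (ex_intro _ k xk : exists i,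
    (fun i => `|target Wd m - W (x i)| <= eps) i).
  exists (sample c k'.+1); split => //; first exact: sample_ge0.
  elim/ltn_ind => -[//|i] IH _; rewrite sample_lt => ik st.
  have /mink' : `|target Wd m - W (x i)| <= eps; last by lia.
  rewrite -correct// => i' /andP[i'0 i'i].
  by apply: IH => //; rewrite sample_lt; lia.
apply: contrapT => /forallNP never.
have ns : forall i, (0 < i)%N -> ~ stops_at sigma W eps Wd m c phi S P0 i.
  elim/ltn_ind => -[//|i] IH _ st; apply: (never i).
  rewrite -correct// => i' /andP[i'0 i'i].
  exact: IH.
have mE i : measured sigma W m c phi S P0 i.+1 = W (x i).
  by apply: correct => i' /andP[? _]; exact: ns.
pose s0 := path_signal sigma (fun=> Wmin) (gain c * eps) (layer m).
have s0_gt0 : 0 < s0.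
  have ge : 0 < gain c * eps <= gain c * eps by rewrite mulr_gt0//=.
  by have /andP[] := path_signal_ge sigma_act Wmin_gt0 (layer m)
    (fun i => path_weight_bounds Wbounds (phi 0) (route c) i) ge.
suff [i] : exists i, `|target Wd m - W (x i)| <= eps by exact: never.
apply: (feedback_reaches (c := s0 * period c)
  W_mono W_lip beta_gt0 eps_gt0 _ W_xd).
  exact: mulr_gt0.
move=> i; set e := target Wd m - W (x i) => ei.
pose rate t :=
  flux_rate sigma W (phi t) (S t) (P0 t) (layer m) (row_of m) (col_of m).
have sol j := controlled_circuit ctrl (DS j) layer_lt (row_of m) (col_of m).
have xE j : x j = phi 0 (layer m) (row_of m) (col_of m)
    + \int[mu]_(t in `[0, sample c j.+1]) rate t by case: (sol j.+1).
have dE : x i.+1 - x i = \int[mu]_(t in `[0, sample c i.+2]) rate t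
    - \int[mu]_(t in `[0, sample c i.+1]) rate t by rewrite !xE; ring.
have rateE t : sample c i.+1 < t <= sample c i.+2 -> rate t =
    path_signal sigma (path_weight W (phi t) (route c)) (gain c * e) (layer m).
  move=> ti; have D_t : D t.
    by apply: Dt; case/andP: ti => /ltW + _; apply: le_trans; exact: sample_ge0.
  rewrite /rate (flux_rate_on_path _ sigma_act _ gamma_path
    (controlled_switches ctrl D_t) (u := gain c * e)) ?target_on_path//.
  move=> b bE; rewrite (input_command ctrl D_t ti _ bE)/=; first by rewrite mE.
  by move=> i' /andP[i'0 _]; exact: ns.
pose s1 := (eta * Wmax) ^+ layer m * (gain c * `|e|).
have wb t := path_weight_bounds Wbounds (phi t) (route c).
have int2 : mu.-integrable `[0, sample c i.+2] (EFin \o rate) by case: (sol i.+2).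
have s12 : 0 <= sample c i.+1 <= sample c i.+2.
  by rewrite sample_ge0/= ltW// sample_lt.
have s1_small : beta * (s1 * period c) <= `|e|.
  have -> : beta * (s1 * period c) =
      beta * ((eta * Wmax) ^+ layer m * gain c * period c) * `|e|.
    by rewrite /s1; ring.
  by rewrite ler_piMl// loop_gain_le1.
have bound_s1 t : `|path_signal sigma (path_weight W (phi t) (route c))
    (gain c * e) (layer m)| <= s1.
  apply: le_trans (path_signal_le sigma_act Wmin_gt0 _ _ (wb t)) _.
  by rewrite normrM (gtr0_norm gain_gt0).
have [e0|e0] := ltrP 0 e.
  have rb t : sample c i.+1 < t <= sample c i.+2 -> s0 <= rate t <= s1.
    move=> /rateE ->; rewrite (le_trans (ler_norm _) (bound_s1 t)) andbT.
    have ge : 0 < gain c * eps <= gain c * e.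
      by rewrite mulr_gt0//= ler_pM2l// -(gtr0_norm e0) ltW.
    by case/andP: (path_signal_ge sigma_act Wmin_gt0 (layer m) (wb t) ge).
  have := increment_bounds s12 int2 rb; rewrite -dE sampleS => /andP[d1 d2].
  have d0 : 0 < x i.+1 - x i by apply: lt_le_trans d1; exact: mulr_gt0.
  rewrite (gtr0_norm d0); split => //; first by rewrite ltW// mulr_gt0.
  by apply: le_trans s1_small; rewrite ler_pM2l.
have rb t : sample c i.+1 < t <= sample c i.+2 -> - s1 <= rate t <= - s0.
  move=> /rateE ->; have := bound_s1 t; rewrite ler_norml => /andP[-> _]/=.
  have ge : 0 < gain c * eps <= gain c * - e.
    by rewrite mulr_gt0//= ler_pM2l// -(ler0_norm e0) ltW.
  have /andP[_] := path_signal_ge sigma_act Wmin_gt0 (layer m) (wb t) ge.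
  by rewrite mulrN (path_signalN sigma_act) lerNr.
have := increment_bounds s12 int2 rb; rewrite -dE sampleS !mulNr => /andP[d1 d2].
have d0 : x i.+1 - x i < 0.
  by apply: le_lt_trans d2 _; rewrite oppr_lt0; exact: mulr_gt0.
rewrite (ltr0_norm d0); split; last by rewrite lerNr.
  by rewrite mulr_le0// ltW.
by apply: le_trans s1_small; rewrite ler_pM2l// lerNl.
Qed.

End WritingPhase.

(** * The order of the phases *)

Section WritingOrder.
Variables (L : nat) (n : nat -> nat).
Implicit Types m : memristor L n.

Lemma site_eta m : m = site (row_of m) (col_of m).
Proof. by case: m => l [k j]. Qed.

Lemma memristor_inj m m' : layer m = layer m' ->
  row_of m = row_of m' :> nat -> col_of m = col_of m' :> nat -> m = m'.
Proof.
case: m m' => [l [k j]] [l' [k' j']]; rewrite /layer/= => ll; subst l'.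
by rewrite /row_of /col_of/= => /val_inj -> /val_inj ->.
Qed.

Lemma mem_writing_order m : m \in writing_order L n.
Proof.
apply/flatten_mapP; exists (layer m); first by rewrite mem_rev mem_enum.
apply/allpairsP; exists (col_of m, row_of m); split; rewrite ?mem_enum//=.
exact: site_eta.
Qed.

(** By counting: every device occurs, and there are as many entries as
    devices. *)
Lemma writing_order_uniq : uniq (writing_order L n).
Proof.
apply: (@leq_size_uniq _ (enum {: {l : 'I_L & ('I_(n l.+1) * 'I_(n l))%type}})).
- exact: enum_uniq.
- by move=> m _; exact: mem_writing_order.
rewrite -cardE card_tagged size_flatten /shape -map_comp map_rev.
rewrite (perm_sumn (permEl (perm_rev _))) leq_eqVlt; apply/orP; left; apply/eqP.
congr sumn; apply: eq_map => l /=.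
by rewrite size_allpairs -!cardE card_prod !card_ord mulnC.
Qed.

Lemma phase_of_index p : (p < size (writing_order L n))%N ->
  exists m, index m (writing_order L n) = p.
Proof.
case E : (writing_order L n) => [//|m0 s] ps.
exists (nth m0 (writing_order L n) p).
by rewrite -E index_uniq ?writing_order_uniq// E.
Qed.

Lemma big_writing_order (R : zmodType) (F : memristor L n -> R) :
  \sum_(m <- writing_order L n) F m =
  \sum_(l < L) \sum_(k < n l.+1) \sum_(j < n l) F (site k j).
Proof.
rewrite big_flatten big_map (perm_big _ (permEl (perm_rev _))) big_enum/=.
apply: eq_bigr => l _.
by rewrite big_allpairs_dep big_enum/= exchange_big/= big_enum.
Qed.

(** The property of the order on which the persistence of written values
    rests. *)
Lemma writing_order_layers m m' :
  (index m (writing_order L n) < index m' (writing_order L n))%N ->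
  (layer m' <= layer m)%N.
Proof.
have blocks : pairwise (fun l l' : 'I_L => (l' <= l)%N) (rev (enum 'I_L)).
  rewrite -sorted_pairwise; last by move=> a b c ab ca; exact: leq_trans ca ab.
  have := iota_sorted 0 L; rewrite -val_enum_ord sorted_map rev_sorted.
  exact.
have : pairwise (fun m m' => layer m' <= layer m)%N (writing_order L n).
  rewrite /writing_order; elim: (rev _) blocks => //= l s IH /andP[ls /IH {}IH].
  rewrite pairwise_cat IH andbT; apply/andP; split.
    apply/allrelP => x y /allpairsP[[j k] [_ _ ->]] /flatten_mapP[l' l's].
    by case/allpairsP => -[j' k'] [_ _ ->]; exact: (allP ls).
  have inl : all (fun x => layer x == l)
      [seq site k j | j <- enum 'I_(n l), k <- enum 'I_(n l.+1)].
    by apply/allP => x /allpairsP[[j k] [_ _ ->]] /=.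
  elim: [seq _ | _ <- _, _ <- _] inl => //= x s' IHs /andP[/eqP xl sl].
  rewrite IHs// andbT; apply: sub_all sl => y /eqP ->.
  by rewrite xl.
move=> /(pairwiseP m) pw mm'.
have := pw _ _ _ _ mm'; rewrite !inE !index_mem !mem_writing_order.
by rewrite !nth_index ?mem_writing_order//; exact.
Qed.

End WritingOrder.

(** * The full procedure *)

Section Procedure.
Variables (R : realType) (L : nat) (n : nat -> nat) (sigma W : R -> R).
Variables (eta beta Wmin Wmax eps : R) (Wd : forall l, 'M[R]_(n l.+1, n l)).
Implicit Types (m : memristor L n) (r : run R L n).
Notation order := (writing_order L n).
Notation phase_completed := (phase_completed sigma W beta eta Wmax eps Wd).
Notation completed := (completed sigma W beta eta Wmax eps Wd).

(** A phase that ends at [tau] only sees the fluxes up to that time. This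
    allows to cut off a closed loop when its phase ends and to let the next
    phase go on from there. *)
Lemma phase_restrict m (c : tuning R) (phi psi : R -> fluxes R n)
    (S : R -> switches n) (P0 : R -> 'cV[R]_(n 0%N)) (D : set R) tau :
  0 < period c ->
  (forall t, 0 <= t <= tau -> D t /\ phi t = psi t) ->
  controlled sigma W eps Wd m c phi S P0 D ->
  ends_at sigma W eps Wd m c phi S P0 tau ->
  controlled sigma W eps Wd m c psi S P0 `[0, tau]%classic /\
  ends_at sigma W eps Wd m c psi S P0 tau.
Proof.
move=> T0 Dphi [circ sw pr fb] [tau0 ns st].
have inD t : (`[0, tau]%classic : set R) t -> 0 <= t <= tau.
  by rewrite /= in_itv.
have stopsE i : sample c i <= tau ->
    stops_at sigma W eps Wd m c psi S P0 i ->
    stops_at sigma W eps Wd m c phi S P0 i.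
  move=> it; rewrite /stops_at /measured; have [|_ ->//] := Dphi (sample c i).
  by rewrite it andbT mulr_ge0// ltW.
split; last first.
  split=> //; first by move=> i i0 it /stopsE/ns; apply => //; exact: ltW.
  by have [|_ <-] := Dphi tau; rewrite ?tau0/=.
split.
- move=> t /inD tD l lL a b.
  have [int_phi phiE] := circ t (Dphi t tD).1 l lL a b.
  have rE s : s \in `[0, t]%classic ->
      flux_rate sigma W (phi s) (S s) (P0 s) l a b =
      flux_rate sigma W (psi s) (S s) (P0 s) l a b.
    rewrite inE/= in_itv/= => /andP[s0 st']; have [|_ ->//] := Dphi s.
    by rewrite s0 (le_trans st')//; case/andP: tD.
  split.
    apply: (@eq_integrable _ _ _ lebesgue_measure `[0, t]%classic
      (measurable_itv _)
      (fun s => (flux_rate sigma W (phi s) (S s) (P0 s) l a b)%:E)) int_phi.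
    by move=> s sI /=; rewrite rE.
  rewrite -(Dphi t tD).2 -(Dphi 0 _).2 ?lexx// phiE.
  congr (_ + _); apply: (@eq_Rintegral _ _ _ lebesgue_measure `[0, t]%classic).
  by move=> s sI; rewrite rE.
- by move=> t /inD/Dphi[Dt _]; exact: sw.
- by move=> t /inD/Dphi[Dt _]; exact: pr.
- move=> i t i0 /inD tD ti nst b bE.
  have sampleE i' : (i' <= i)%N -> sample c i' <= tau.
    move=> i'i; have /andP[_ ttau] := tD; have /andP[/ltW it _] := ti.
    by apply: le_trans (le_trans it ttau); rewrite ler_pM2r// ler_nat.
  rewrite (fb i t i0 (Dphi t tD).1 ti _ b bE).
    rewrite /measured; have [|_ ->//] := Dphi (sample c i).
    by rewrite sampleE// mulr_ge0// ltW.
  move=> i' i'i; apply: contra_not (nst i' i'i).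
  rewrite /stops_at /measured; have [|_ ->//] := Dphi (sample c i').
  by rewrite sampleE ?mulr_ge0// ?ltW//; case/andP: i'i.
Qed.

Definition elapsed r p : R := \sum_(m <- take p order) duration r m.

Lemma start_elapsed r m : start r m = elapsed r (index m order).
Proof. by []. Qed.

Lemma elapsedS r m :
  elapsed r (index m order).+1 = start r m + duration r m.
Proof.
rewrite /elapsed (take_nth m) ?index_mem ?mem_writing_order//.
by rewrite nth_index ?mem_writing_order// -cats1 big_cat big_seq1.
Qed.

Lemma elapsed_total r : elapsed r (size order) =
  \sum_(l < L) \sum_(k < n l.+1) \sum_(j < n l) duration r (site k j).
Proof. by rewrite /elapsed take_size big_writing_order. Qed.

Lemma elapsed_le r p q :
  (forall m, (index m order < q)%N -> 0 <= duration r m) -> (p <= q)%N ->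
  elapsed r p <= elapsed r q.
Proof.
move=> dur pq; rewrite /elapsed -(cat_take_drop p (take q order)) take_takel//.
rewrite big_cat lerDl big_seq; apply: sumr_ge0 => m mq.
by apply: dur; have /mem_drop := mq; exact: index_ltn.
Qed.

Lemma completed_duration phi0 r p m : completed phi0 r p ->
  (index m order < p)%N -> 0 <= duration r m.
Proof. by move=> [_ h] /h [_ _ []]. Qed.

Hypotheses (sigma_act : activation eta sigma) (Wmin_gt0 : 0 < Wmin)
  (Wbounds : forall x, Wmin <= W x <= Wmax) (eps_gt0 : 0 < eps).

(** What has been written is not overwritten: the phase of a later device
    drives, in this layer, at most its own site. *)
Lemma written_persists phi0 r m p : completed phi0 r p -> (p <= size order)%N ->
  (index m order < p)%N ->
  `|target Wd m - W (flux r (elapsed r p) (layer m) (row_of m) (col_of m))|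
    <= eps.
Proof.
elim: p => // p IH [init ph] psz; rewrite ltnS leq_eqVlt => /predU1P[mp|mp].
  have [_ _ [_ _]] := ph m (eq_leq (congr1 S mp)).
  by rewrite -mp elapsedS.
have {}IH := IH (conj init (fun m' h => ph m' (leqW h))) (ltnW psz) mp.
have [m' m'p] := phase_of_index psz.
have [adm ctrl [dur0 _ _]] := ph m' (eq_leq (congr1 S m'p)).
have [gp _ _ _ _] := adm.
have off : ~~ on_path m' (route (tuned r m')) (layer m) (row_of m) (col_of m).
  apply/negP => /and3P[l1 /eqP rowE /eqP colE].
  have l2 : (layer m' <= layer m)%N.
    by apply: (@writing_order_layers _ _ m m'); rewrite m'p.
  have ll : layer m = layer m' by apply/val_inj/anti_leq/andP; split.
  have [_ colE' rowE'] := gp.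
  have mm' : m = m'.
    by apply: memristor_inj => //; rewrite ?rowE ?colE ll.
  by move: mp; rewrite -m'p -mm' ltnn.
have := @flux_off_path R L n sigma W eta sigma_act m' _ _ _ _ _ (duration r m')
  _ _ _ gp (controlled_circuit ctrl) (controlled_switches ctrl) _ _
  (ltn_ord (layer m)) off.
have sE : start r m' = elapsed r p by rewrite -m'p.
rewrite /phase_flux addr0 => same.
have -> : elapsed r p.+1 = start r m' + duration r m' by rewrite -m'p elapsedS.
have inD s : 0 <= s <= duration r m' ->
    (`[0, duration r m']%classic : set R) s.
  by rewrite /= in_itv.
by rewrite same ?sE//; apply: inD; rewrite dur0 lexx.
Qed.

(** ** Carrying out the phases one after the other *)

Hypotheses (W_mono : strictly_monotone W) (W_lip : beta.-lipschitz W)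
  (beta_gt0 : 0 < beta) (W_cont : continuous W)
  (W_attains : forall m, exists xd, W xd = target Wd m).

Definition route_switches m (gamma : nat -> nat) : switches n :=
  fun l => \matrix_(a, b) on_path m gamma l a b.

Lemma route_switchesP m gamma :
  switched_along m gamma (route_switches m gamma).
Proof.
move=> l lL a b; rewrite mxE /on_path; split=> [->//|lm].
by rewrite [X in (X <= _)%N]lm ltnn.
Qed.

(** A run is extended by one phase at a time: the fluxes are kept until the
    elapsed time and replaced from there on by a closed loop that starts from
    the value reached. *)
Lemma procedure_feasible phi0 (c : memristor L n -> tuning R) p :
  (forall m, admissible beta eta Wmax m (c m)) -> (p <= size order)%N ->
  exists2 r : run R L n, tuned r = c & completed phi0 r p.
Proof.
move=> adm; elim: p => [_|p IH psz].
  by exists (Run (fun=> phi0) (fun=> 0) c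
    (fun m _ => route_switches m (route (c m))) (fun _ _ => 0)).
have [r rc comp] := IH (ltnW psz).
have [m mp] := phase_of_index psz.
have [init ph] := comp.
pose S (t : R) := route_switches m (route (c m)).
have swS (t : R) : 0 <= t -> switched_along m (route (c m)) (S t).
  by move=> _; exact: route_switchesP.
have [psi [P0 [psi0 _ ctrl]]] := phase_feasible Wd sigma_act Wmin_gt0 Wbounds
  eps_gt0 (adm m) W_cont (flux r (start r m)) (fun=> 0) swS.
have [xd W_xd] := W_attains m.
have [tau endtau] := phase_terminates sigma_act Wmin_gt0 Wbounds eps_gt0 (adm m)
  W_mono W_lip beta_gt0 W_xd ctrl.
pose t0 := start r m.
pose r' := Run
  (fun t => if t <= t0 then flux r t else psi (t - t0))
  (fun m' => if m' == m then tau else duration r m') c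
  (fun m' => if m' == m then S else switch r m')
  (fun m' => if m' == m then P0 else input r m').
have dur m' : (index m' order < p)%N -> 0 <= duration r m'.
  exact: completed_duration comp.
have start_r' m' : (index m' order <= p)%N -> start r' m' = start r m'.
  move=> m'p; rewrite /start big_seq [RHS]big_seq; apply: eq_bigr => m2.
  move=> /index_ltn m2m' /=; case: eqP => // m2m.
  by move: m2m'; rewrite m2m mp ltnNge m'p.
have t0_ge0 : 0 <= t0.
  rewrite /t0 start_elapsed mp.
  by have := @elapsed_le r 0 p dur (leq0n _); rewrite {1}/elapsed take0 big_nil.
have T_gt0 m' : 0 < period (c m') by case: (adm m').
exists r' => //; split; first by move=> l lL /=; rewrite t0_ge0 init.
move=> m'; rewrite ltnS leq_eqVlt => /predU1P[m'p|m'p].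
  have -> : m' = m.
    have mS := mem_writing_order m; have m'S := mem_writing_order m'.
    by rewrite -(nth_index m m'S) m'p -mp nth_index.
  have agree t : 0 <= t <= tau ->
      (`[0, +oo[%classic : set R) t /\ psi t = phase_flux r' m t.
    move=> /andP[t_ge0 _]; split; first by rewrite /= in_itv/= andbT.
    rewrite /phase_flux /= start_r' ?mp// -/t0 gerDl addrAC subrr add0r.
    case: ifP => // t_le0; have -> : t = 0 by apply/eqP; rewrite eq_le t_le0.
    by rewrite addr0 psi0.
  have [ctrl' end'] := phase_restrict (T_gt0 m) agree ctrl endtau.
  by split => /=; rewrite ?eqxx//.
have m'm : m' != m by apply: contraTneq m'p => ->; rewrite mp ltnn.
have [adm' ctrlr endr] := ph m' m'p.
have agree t : 0 <= t <= duration r m' ->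
    (`[0, duration r m']%classic : set R) t /\
    phase_flux r m' t = phase_flux r' m' t.
  move=> tD; split; first by rewrite /= in_itv.
  rewrite /phase_flux /= start_r' ?(ltnW m'p)//.
  have -> // : start r m' + t <= t0.
  apply: (@le_trans _ _ (elapsed r (index m' order).+1)).
    by rewrite elapsedS lerD2l; case/andP: tD.
  by rewrite /t0 start_elapsed mp; exact: elapsed_le.
have [] := phase_restrict _ agree ctrlr endr; rewrite rc; first exact: T_gt0.
by move=> ctrl' end'; split; rewrite /= ?(negbTE m'm).
Qed.

End Procedure.

(** * The writing problem *)

Theorem corollary2 (R : realType) (L : nat) (n : nat -> nat)
    (sigma g : R -> R) (eta beta Wmin Wmax eps : R)
    (Wd : forall l, 'M[R]_(n l.+1, n l)) :
  let W : R -> R := derive1 g in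
  (0 < L)%N ->
  (forall l, (l <= L)%N -> (0 < n l)%N) ->
  activation eta sigma ->
  memristive beta Wmin Wmax g ->
  0 < eps ->
  (forall l, (l < L)%N -> realizable W (Wd l)) ->
  forall phi0 : fluxes R n,
  let completed := completed (L := L) sigma W beta eta Wmax eps Wd phi0 in
  let controlled := controlled (L := L) sigma W eps Wd in
  let ends_at := ends_at (L := L) sigma W eps Wd in
  [/\ (* each phase can be carried out, whatever the choices made in it and
         in the preceding phases, and reaches its termination criterion *)
      forall (r : run R L n) (m : memristor L n) (c : tuning R),
        completed r (index m (writing_order L n)) ->
        admissible beta eta Wmax m c ->
        (forall (S : R -> switches n) (Q : R -> 'cV[R]_(n 0%N)),
          (forall t, 0 <= t -> switched_along m (route c) (S t)) ->
          exists (phi : R -> fluxes R n) (P0 : R -> 'cV[R]_(n 0%N)),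
            [/\ same_fluxes L (phi 0) (flux r (start r m)),
                forall t (b : 'I_(n 0%N)), b != route c 0 :> nat ->
                  P0 t b 0 = Q t b 0 &
                controlled m c phi S P0 `[0, +oo[%classic]) /\
        (forall (phi : R -> fluxes R n) (S : R -> switches n)
            (P0 : R -> 'cV[R]_(n 0%N)),
          same_fluxes L (phi 0) (flux r (start r m)) ->
          controlled m c phi S P0 `[0, +oo[%classic ->
          exists tau, ends_at m c phi S P0 tau),
      (* the full procedure can be carried out *)
      forall c : memristor L n -> tuning R,
        (forall m, admissible beta eta Wmax m (c m)) ->
        exists2 r : run R L n, tuned r = c &
          completed r (size (writing_order L n))
    & (* and it solves the writing problem *)
      forall r : run R L n,
        completed r (size (writing_order L n)) ->
        let Ttot :=
          \sum_(l < L) \sum_(k < n l.+1) \sum_(j < n l) duration r (site k j) in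
        forall (l : 'I_L) (k : 'I_(n l.+1)) (j : 'I_(n l)),
          `|Wd l k j - W (flux r Ttot l k j)| <= eps].
Proof.
move=> W L_gt0 n_gt0 sigma_act g_mem eps_gt0 Wd_real phi0 /=.
have [[_ W_cont] _ W_mono beta_gt0 W_lip Wmin_gt0 _ Wbounds] := g_mem.
have W_attains (m : memristor L n) : exists xd, W xd = target Wd m.
  have [_ [phi WdE]] := Wd_real _ (ltn_ord (layer m)).
  by exists (phi (row_of m) (col_of m)); rewrite /target WdE mxE.
split.
- move=> r m c _ c_adm; split.
    move=> S Q sw.
    have [phi [P0 [phiE P0E ctrl]]] := phase_feasible Wd sigma_act Wmin_gt0
      Wbounds eps_gt0 c_adm W_cont (flux r (start r m)) Q sw.
    by exists phi, P0; split=> // l lL; rewrite phiE.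
  move=> phi S P0 _ ctrl; have [xd W_xd] := W_attains m.
  exact: (phase_terminates sigma_act Wmin_gt0 Wbounds eps_gt0 c_adm
    W_mono W_lip beta_gt0 W_xd ctrl).
- move=> c c_adm.
  exact: (procedure_feasible sigma_act Wmin_gt0 Wbounds eps_gt0 W_mono W_lip
    beta_gt0 W_cont W_attains).
- move=> r comp l k j; rewrite -elapsed_total.
  have done_kj :
      (index (site k j) (writing_order L n) < size (writing_order L n))%N.
    by rewrite index_mem mem_writing_order.
  exact: (written_persists sigma_act comp (leqnn _) done_kj).
Qed.
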